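(* Let $f,g\in\mathbb{R}[x]$ with $f\neq 0$, and let $g_\bullet=(g_0,\dotsc,g_k)$ be the reduced Sylvester sequence of $f$ and $g$. For all $a<b$ in $\mathbb{R}\cup\{\pm\infty\}$ we have $$\operatorname{var}(g_\bullet,a)-\operatorname{var}(g_\bullet,b)\;=\;\#\{\zeta\in(a,b]\mid f(\zeta)=0\text{ and }g(\zeta)>0\}\;-\;\#\{\zeta\in[a,b)\mid f(\zeta)=0\text{ and }g(\zeta)<0\}.$$
   Context: Variation: for a finite sequence $c=(c_0,\dotsc,c_k)$ of real numbers, $\operatorname{var}(c)$ is the number of sign changes in $c$ after removing all zero terms; that is, if $(d_0,\dotsc,d_m)$ is the sequence of nonzero terms of $c$ in order, then $\operatorname{var}(c)=\#\{1\le i\le m\mid d_{i-1}d_i<0\}$. For a sequence of polynomials $f_\bullet=(f_0,\dotsc,f_k)$ in $\mathbb{R}[x]$ and $a\in\mathbb{R}$, $\operatorname{var}(f_\bullet,a)$ is the variation of the sequence $(f_0(a),\dotsc,f_k(a))$. This is extended to $a\in\{\pm\infty\}$ by taking $f(\infty)$ to be the leading coefficient of $f(x)$ and $f(-\infty)$ to be the leading coefficient of $f(-x)$, for a polynomial $f$. Sylvester sequence: for $f,g\in\mathbb{R}[x]$, $\operatorname{Syl}(f,g)$ is the sequence $(f_0,f_1,\dotsc,f_k)$ of nonzero polynomials, where $f_0:=f$, $f_1:=f'\cdot g$, and for $i\ge 1$, $f_{i+1}:=-\operatorname{remainder}(f_{i-1},f_i)$ is the negative of the remainder in the division of $f_{i-1}$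 by $f_i$. The sequence ends with the last nonzero term $f_k$, which is a greatest common divisor of $f$ and $f'g$ (if $f'g=0$, the sequence is just $(f_0)$). Reduced Sylvester sequence: the sequence $g_\bullet=(g_0,\dotsc,g_k)$ obtained by dividing each term of $\operatorname{Syl}(f,g)$ by $f_k$, so that $g_if_k=f_i$ for each $i$; in particular $g_k=1$. (The polynomial $g$ is distinct from the terms $g_i$ of this sequence.) The sets whose cardinalities appear in the claim consist of real numbers $\zeta$, so roots of $f$ are counted without multiplicity. *)

(* Defs.v *)
From mathcomp Require Import all_boot all_order all_algebra.
From mathcomp Require Import finmap.
From mathcomp Require Import boolp classical_sets cardinality reals constructive_ereal.

Set Implicit Arguments.
Unset Strict Implicit.
Unset Printing Implicit Defensive.

Import Order.TTheory GRing.Theory Num.Theory.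
Local Open Scope ring_scope.

Definition variation (R : realType) (c : seq R) : nat :=
  let d := [seq x <- c | x != 0] in
  (\sum_(1 <= i < size d) (d`_i.-1 * d`_i < 0)%R)%N.

Definition eval_ext (R : realType) (p : {poly R}) (a : \bar R) : R :=
  match a with
  | r%:E => p.[r]
  | +oo%E => lead_coef p
  | -oo%E => lead_coef (p \Po (- 'X))
  end.

Definition variation_at (R : realType) (fs : seq {poly R}) (a : \bar R) : nat :=
  variation [seq eval_ext p a | p <- fs].

(* The fuel [n] is sufficient as soon as [size q <= n], since the size of the
   second argument strictly decreases at each step; see [signed_remsE]. *)
Fixpoint signed_rems_rec (R : realType) (n : nat) (p q : {poly R}) :
    seq {poly R} :=
  if n is m.+1 then
    if q == 0 then [:: p] else p :: signed_rems_rec m q (- (p %% q))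
  else [:: p].

Definition signed_rems (R : realType) (p q : {poly R}) : seq {poly R} :=
  signed_rems_rec (size q) p q.

Definition Syl (R : realType) (f g : {poly R}) : seq {poly R} :=
  signed_rems f (f^`() * g).

(* The divisions by the last term are exact; see [reduced_SylK]. *)
Definition reduced_Syl (R : realType) (f g : {poly R}) : seq {poly R} :=
  [seq p %/ last 0 (Syl f g) | p <- Syl f g].

Lemma signed_rems_rec_fuel (R : realType) (m n : nat) (p q : {poly R}) :
  (size q <= m)%N -> (size q <= n)%N ->
  signed_rems_rec m p q = signed_rems_rec n p q.
Proof.
elim: m n p q => [|m IHm] [|n] p q //=.
- by rewrite leqn0 size_poly_eq0 => ->.
- by move=> _; rewrite leqn0 size_poly_eq0 => ->.
case: eqP => // /eqP q0 sm sn; congr (_ :: _).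
by apply: IHm; rewrite size_polyN -ltnS; apply: leq_trans (ltn_modpN0 p q0) _.
Qed.

Lemma signed_remsE (R : realType) (p q : {poly R}) :
  signed_rems p q =
  if q == 0 then [:: p] else p :: signed_rems q (- (p %% q)).
Proof.
rewrite {1}/signed_rems (@signed_rems_rec_fuel R (size q) (size q).+1) //=.
case: eqP => // /eqP q0; congr (_ :: _).
by apply: signed_rems_rec_fuel; rewrite ?size_polyN // ltnW // ltn_modpN0.
Qed.

Lemma signed_rems_dvd_last (R : realType) (x p q : {poly R}) :
  let d := last x (signed_rems p q) in
  [/\ d %| p, d %| q & forall r, r \in signed_rems p q -> d %| r].
Proof.
have [n] := ubnP (size q); elim: n x p q => // n IHn x p q sq.
rewrite signed_remsE; case: eqP => [->|/eqP q0] /=.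
  by split=> [||r]; rewrite ?dvdpp ?dvdp0 // inE => /eqP ->.
have [|dq dr dall] := IHn p q (- (p %% q)).
  by rewrite size_polyN; apply: leq_trans (ltn_modpN0 p q0) _; rewrite -ltnS.
have dp : last p (signed_rems q (- (p %% q))) %| p.
  by rewrite [X in _ %| X](divp_eq p q) dvdp_add ?dvdp_mull // -dvdpNr.
by split=> // r; rewrite inE => /predU1P[->|/dall].
Qed.

Lemma reduced_SylK (R : realType) (f g : {poly R}) :
  [seq p * last 0 (Syl f g) | p <- reduced_Syl f g] = Syl f g.
Proof.
rewrite /reduced_Syl -map_comp -[RHS]map_id; apply/eq_in_map => p pS /=.
have [_ _ dvd_last] := signed_rems_dvd_last 0 f (f^`() * g).
by rewrite divpK // dvd_last.
Qed.

(* Cardinalities of sets of roots are taken with [fset_set], which returns the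
   empty set on infinite sets; this excludes that case. *)
Lemma finite_set_roots (R : realType) (f : {poly R}) :
  f != 0 -> finite_set [set z : R | f.[z] = 0]%classic.
Proof.
move=> f0; apply: contrapT => /infinite_set_fset => /(_ (size f))[B Bf].
rewrite leqNgt max_poly_roots ?fset_uniq //.
by apply/allP => z zB; apply/eqP; apply: Bf.
Qed.

(* Main.v *)
Require Import Defs.
From mathcomp Require Import all_boot all_order all_algebra.
From mathcomp Require Import finmap zify ring.
From mathcomp Require Import boolp classical_sets cardinality reals constructive_ereal.
From mathcomp Require Import topology normedtype derive realfun.
From mathcomp Require Import polyrcf.

Set Implicit Arguments.
Unset Strict Implicit.
Unset Printing Implicit Defensive.

Import Order.TTheory GRing.Theory Num.Theory.
Import numFieldNormedType.Exports.
Local Open Scope ring_scope.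

(** Write V(x) for the variation of the reduced sequence at x, and consider
    the potential
      F(x) = V(x) + #{z <= x | f(z) = 0, g(z) > 0}
                  - #{z < x | f(z) = 0, g(z) < 0}.
    The theorem says exactly that F takes the same value at a and b, so it
    suffices that F is locally constant on the real line (hence constant) and
    that its values at the two infinities are attained at real points.

    Local constancy at c. Consecutive terms of the reduced sequence satisfy
    g_(i-1) + g_(i+1) = h g_i and the last term is 1, so two neighbours never
    vanish together, and where an inner term vanishes its two neighbours have
    opposite signs: such a triple contributes one sign change whatever the
    sign of the middle term. Hence V does not jump at c unless g_0(c) = 0
    ([sturm_chain_variation_near]).

    If d is the last Sylvester term, then g_0 d = f and g_1 d = f' g. Comparing
    logarithmic derivatives, near a root c of f of multiplicity m, g_1 / g_0 is
    g f' / f, which behaves like m g / (x - c). Therefore g_0(c) = 0 if and only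
    if f(c) = 0 and g(c) <> 0 ([quotient_root]), and then g_0 g_1 has the sign of
    g(c) (x - c) around c ([near_sg_quotients]). So, compared with its value at
    c, V is larger by one on the left of c if g(c) > 0, on the right of c if
    g(c) < 0. These are the jumps, with opposite signs, of the two counting
    functions in F: a root with g > 0 is counted from c on, one with g < 0 only
    after c. *)

(** * Sign variations *)

Lemma variation0 (R : realType) (s : seq R) : variation (0 :: s) = variation s.
Proof. by rewrite /variation /= eqxx. Qed.

Lemma variation_cons (R : realType) (x : R) (s : seq R) : x != 0 ->
  variation (x :: s)
  = ((x * head 0 [seq y <- s | y != 0] < 0)%R + variation s)%N.
Proof.
move=> x0; rewrite /variation /= x0.
case: [seq y <- s | y != 0] => [|y t] /=.
  by rewrite mulr0 ltxx !big_geq.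
rewrite big_ltn //= big_add1 /=; congr addn.
by rewrite big_nat [RHS]big_nat; apply: eq_bigr => -[].
Qed.

Lemma variation_cons2 (R : realType) (x y : R) (s : seq R) :
  y != 0 ->
  variation (x :: y :: s) = ((x * y < 0)%R + variation (y :: s))%N.
Proof.
move=> y0; have [->|x0] := eqVneq x 0; first by rewrite variation0 mul0r ltxx.
by rewrite variation_cons //= y0.
Qed.

Lemma variation_cons_zero (R : realType) (x : R) (s : seq R) :
  variation (x :: 0 :: s) = variation (x :: s).
Proof. by rewrite /variation /= eqxx. Qed.

(** The middle entry is arbitrary, possibly zero: between two entries of opposite
    signs there is one sign change in any case. This makes roots of inner terms
    of a Sturm sequence invisible. *)
Lemma variation_straddle (R : realType) (x y z : R) (s : seq R) : x * z < 0 ->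
  variation (x :: y :: z :: s) = (variation (z :: s)).+1.
Proof.
move=> xz.
have z0 : z != 0 by apply: contraTneq xz => ->; rewrite mulr0 ltxx.
have [->|y0] := eqVneq y 0.
  by rewrite variation_cons_zero variation_cons2 // xz.
rewrite !variation_cons2 // addnA -[RHS]add1n; congr (_ + _)%N.
case: (ltrgt0P x) xz => [xp|xn|->]; last by rewrite mul0r ltxx.
  rewrite pmulr_rlt0 // => zn; rewrite pmulr_rlt0 // nmulr_llt0 //.
  by case: ltrgt0P y0.
rewrite nmulr_rlt0 // => zp; rewrite nmulr_rlt0 // pmulr_llt0 //.
by case: ltrgt0P y0.
Qed.

Lemma variation_sg (R : realType) (s : seq R) :
  variation [seq Num.sg x | x <- s] = variation s.
Proof.
elim: s => [|x s IHs] //=.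
have [->|x0] := eqVneq x 0; first by rewrite sgr0 !variation0.
rewrite !variation_cons ?sgr_eq0 // IHs; congr (nat_of_bool _ + _)%N.
have -> : head 0 [seq y <- [seq Num.sg i | i <- s] | y != 0]
        = Num.sg (head 0 [seq y <- s | y != 0]).
  elim: s {IHs} => [|y s IHs] /=; first by rewrite sgr0.
  by rewrite sgr_eq0; case: eqP.
by rewrite -sgrM sgr_lt0.
Qed.

Lemma eq_variation_sg (R : realType) (T : eqType) (u v : T -> R) (s : seq T) :
  {in s, forall t, Num.sg (u t) = Num.sg (v t)} ->
  variation [seq u t | t <- s] = variation [seq v t | t <- s].
Proof.
move=> uv; rewrite -variation_sg -[RHS]variation_sg -!map_comp.
by congr variation; apply/eq_in_map.
Qed.

(** * The reduced Sylvester sequence as a Sturm chain *)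

(** This keeps only the part of the recurrence that matters for signs: each term
    divides the sum of its two neighbours. For the penultimate term the default 0
    of [head] makes the condition 1 %| p, which is vacuous. *)
Fixpoint sturm_chain (R : realType) (p : {poly R}) (s : seq {poly R}) : bool :=
  if s is q :: s' then (q %| p + head 0 s') && sturm_chain q s' else p == 1.

Lemma behead_signed_rems (R : realType) (p q : {poly R}) :
  behead (signed_rems p q)
  = if q == 0 then [::] else signed_rems q (- (p %% q)).
Proof. by rewrite signed_remsE; case: ifP. Qed.

Lemma last_signed_rems (R : realType) (p q : {poly R}) : q != 0 ->
  last 0 (signed_rems p q) = last 0 (signed_rems q (- (p %% q))).
Proof.
move=> q0; rewrite signed_remsE (negbTE q0) /= signed_remsE.
by case: ifP.
Qed.

(** By the definition of the remainder, consecutive terms satisfy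
    p - (p %% q) = (p %/ q) * q; dividing by the common divisor d keeps this
    relation. *)
Lemma signed_rems_sturm_chain (R : realType) (p q : {poly R}) : p != 0 ->
  let d := last 0 (signed_rems p q) in
  sturm_chain (p %/ d) [seq r %/ d | r <- behead (signed_rems p q)].
Proof.
have [n] := ubnP (size q); elim: n p q => // n IHn p q sq p0 /=.
rewrite behead_signed_rems; case: eqVneq => [->|q0] /=.
  by rewrite signed_remsE eqxx /= divpp.
have [dp dq _] := signed_rems_dvd_last 0 p q.
have [_ dr _] := signed_rems_dvd_last 0 q (- (p %% q)).
have := IHn q (- (p %% q)).
rewrite size_polyN (leq_trans (ltn_modpN0 p q0)) // => /(_ isT q0) /=.
rewrite -last_signed_rems // in dr *.
set d := last 0 _ in dp dq dr * => chS.
have d0 : d != 0 by apply: contraTneq dp => ->; rewrite dvd0p.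
set S := signed_rems _ _ in chS *.
have -> : S = q :: behead S by rewrite /S signed_remsE; case: ifP.
rewrite /= {}chS andbT.
have -> : head 0 [seq r %/ d | r <- behead S] = - (p %% q) %/ d.
  rewrite /S behead_signed_rems.
  case: eqVneq => [->|_] /=; first by rewrite div0p.
  by rewrite signed_remsE; case: ifP.
rewrite -(dvdp_mul2r _ _ d0) mulrDl !divpK //.
by rewrite {1}(divp_eq p q) addrK dvdp_mull.
Qed.

(** When f' g = 0 the sequence stops at its first term, but q = 0 is still the
    right quotient; keeping q available in both cases lets one treat roots of f
    uniformly. *)
Variant reduced_Syl_spec (R : realType) (f g : {poly R}) :
    seq {poly R} -> Prop :=
  ReducedSylSpec (d p q : {poly R}) (s : seq {poly R}) of
    f = p * d & f^`() * g = q * d & sturm_chain p s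
    & (s = [::] \/ exists s', s = q :: s') : reduced_Syl_spec f g (p :: s).

Lemma reduced_SylP (R : realType) (f g : {poly R}) : f != 0 ->
  reduced_Syl_spec f g (reduced_Syl f g).
Proof.
move=> f0; have [df dq _] := signed_rems_dvd_last 0 f (f^`() * g).
have := @signed_rems_sturm_chain R f (f^`() * g) f0.
rewrite /reduced_Syl /Syl; set d := last 0 _ in df dq * => /= ch.
have -> : signed_rems f (f^`() * g) = f :: behead (signed_rems f (f^`() * g)).
  by rewrite signed_remsE; case: ifP.
apply: (@ReducedSylSpec _ _ _ d _ ((f^`() * g) %/ d)) => //; rewrite ?divpK //.
rewrite behead_signed_rems; case: eqVneq => _; [by left | right].
by rewrite signed_remsE; case: ifP => _ /=; eexists.
Qed.

(** * Local behaviour of the variation *)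

Lemma near_sg_horner (R : realType) (p : {poly R}) (c : R) : p.[c] != 0 ->
  \forall y \near c, Num.sg p.[y] = Num.sg p.[c].
Proof.
case: ltrgt0P => // pc _; near=> y.
  rewrite (gtr0_sg pc); apply: gtr0_sg; near: y.
  by apply: (cvgr_gt _ (@continuous_horner R p c)).
rewrite (ltr0_sg pc); apply: ltr0_sg; near: y.
by apply: (cvgr_lt _ (@continuous_horner R p c)).
Unshelve. all: by end_near. Qed.

(** Induction on the chain. If the second term does not vanish at c, the first
    two terms keep their signs; if it does, the third term is the opposite of the
    first at c, so the second term does not affect the count
    ([variation_straddle]) and can be skipped. *)
Lemma sturm_chain_variation_near (R : realType) (p : {poly R})
    (s : seq {poly R}) (c : R) : sturm_chain p s -> p.[c] != 0 ->
  \forall y \near c,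
    variation [seq q.[y] | q <- p :: s] = variation [seq q.[c] | q <- p :: s].
Proof.
have [n] := ubnP (size s); elim: n p s => // n IHn p s + + pc.
case: s => [_ _|q s /= sn /andP[]].
  near=> y; apply: eq_variation_sg => r; rewrite inE => /eqP ->; near: y.
  exact: near_sg_horner.
have [qc|qc] := eqVneq q.[c] 0; last first.
  move=> _ chq; near=> y.
  have sp : Num.sg p.[y] = Num.sg p.[c] by near: y; exact: near_sg_horner.
  have sq : Num.sg q.[y] = Num.sg q.[c] by near: y; exact: near_sg_horner.
  have IH : variation [seq r.[y] | r <- q :: s]
          = variation [seq r.[c] | r <- q :: s] by near: y; exact: IHn.
  rewrite !variation_cons2 -?(sgr_eq0 _.[y]) ?sp ?sq ?sgr_eq0 //.
  by rewrite -sgr_lt0 sgrM sp sq -sgrM sgr_lt0 [X in (_ + X)%N]IH.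
case: s sn => [_ _ /eqP q1|r s sn /dvdpP[h /= prE] /andP[_ chr]].
  by move: qc; rewrite q1 hornerC => /eqP; rewrite oner_eq0.
have rc : r.[c] = - p.[c].
  by apply/eqP; rewrite -addr_eq0 addrC -hornerD prE hornerM qc mulr0.
have prc : p.[c] * r.[c] < 0.
  by rewrite rc mulrN oppr_lt0 lt_def sqr_ge0 sqrf_eq0 pc.
have rc0 : r.[c] != 0 by rewrite rc oppr_eq0.
near=> y.
rewrite !variation_straddle //.
  by congr S; near: y; apply: IHn => //; exact: ltnW.
rewrite -sgr_lt0 sgrM.
have -> : Num.sg p.[y] = Num.sg p.[c] by near: y; exact: near_sg_horner.
have -> : Num.sg r.[y] = Num.sg r.[c] by near: y; exact: near_sg_horner.
by rewrite -sgrM sgr_lt0.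
Unshelve. all: by end_near. Qed.

(** A common root of two neighbours would propagate down to the last term, 1. *)
Lemma sturm_chain_no_common_root (R : realType) (p q : {poly R})
    (s : seq {poly R}) (c : R) :
  sturm_chain p (q :: s) -> p.[c] = 0 -> q.[c] != 0.
Proof.
elim: s p q => [|r s IHs] p q /=.
  by move=> /andP[_ /eqP->] _; rewrite hornerC oner_neq0.
move=> /andP[/dvdpP[h prE] chq] pc; apply/negP => /eqP qc.
have /negP[] := IHs _ _ chq qc.
by apply/eqP; rewrite -[r.[c]]add0r -pc -hornerD prE hornerM qc mulr0.
Qed.

Section AtRoot.
Variables (R : realType) (f g d p q : {poly R}) (c : R).
Hypotheses (f0 : f != 0) (fE : f = p * d) (fgE : f^`() * g = q * d).

(** The estimate (f' / f) g ~ m g / (x - c) at a root c of multiplicity m, with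
    denominators cleared so that it is an identity of polynomials from which d
    has been cancelled. Writing f = u (x - c)^m with u(c) <> 0, one has
    (x - c) f' u = f (m u + (x - c) u'). *)
Lemma log_derivative_identity : f.[c] = 0 ->
  exists a b : {poly R}, [/\ 0 < a.[c], 0 < b.[c] &
    a * ('X - c%:P) * q = b * g * p].
Proof.
move=> fc; have [m [u /implyP/(_ f0) uc fu]] := multiplicity_XsubC f c.
have m0 : (0 < m)%N.
  case: m fu => // fu; move: uc; rewrite -[u]mulr1 -[1](expr0 ('X - c%:P)) -fu.
  by rewrite rootE fc eqxx.
have d0 : d != 0 by apply: contraNneq f0 => d0; rewrite fE d0 mulr0.
have uc2 : 0 < (u ^+ 2).[c].
  by rewrite horner_exp exprn_even_gt0 //= -rootE.
pose w := u *+ m + ('X - c%:P) * u^`().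
(* Multiplying the identity by u makes both cofactors positive at c. *)
exists (u ^+ 2), (u * w); split=> //.
  rewrite /w hornerM hornerD hornerMn hornerM hornerXsubC subrr mul0r addr0.
  by rewrite mulrnAr pmulrn_lgt0 // -hornerM -expr2.
apply: (mulIf d0).
have key : ('X - c%:P) * f^`() * u = f * w.
  rewrite fu derivM deriv_exp derivXsubC mul1r /w.
  case: m m0 {fu w} => // m _ /=.
  rewrite exprS -mulr_natr -[u *+ _]mulr_natr; ring.
transitivity (('X - c%:P) * f^`() * u * (u * g)).
  by rewrite -!mulrA -fgE; ring.
by rewrite key fE; ring.
Qed.

Hypothesis pq : p.[c] = 0 -> q.[c] != 0.

(** The gcd d of f and f' g removes from f all roots of f at which g vanishes, and
    leaves a single factor x - c at the other ones. *)
Lemma quotient_root : (p.[c] == 0) = (f.[c] == 0) && (g.[c] != 0).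
Proof.
have [fc|fc] /= := eqVneq f.[c] 0; last first.
  by apply: contraNF fc => /eqP pc; rewrite fE hornerM pc mul0r.
have [a [b [a0 b0 E]]] := log_derivative_identity fc.
apply/eqP/idP => [pc|gc].
  have /factor_theorem[p1 pE] : root p c by rewrite rootE pc.
  have {}E : a * q = b * g * p1.
    apply: (@mulIf _ ('X - c%:P)); first by rewrite polyXsubC_eq0.
    by rewrite -[RHS]mulrA -pE -E; ring.
  apply: contraTneq (mulf_neq0 (lt0r_neq0 a0) (pq pc)) => gc.
  by rewrite -hornerM E !hornerM gc mulr0 mul0r eqxx.
move/(congr1 (fun r => r.[c])): E.
rewrite !hornerM hornerXsubC subrr mulr0 mul0r.
by move/esym/eqP; rewrite !mulf_eq0 (negbTE gc) gt_eqF //= => /eqP.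
Qed.

(** Multiplying [log_derivative_identity] by q gives
    a (x - c) q^2 = b g (p q), where a, b and q^2 are positive near c. The point
    y = c is included: both sides are then false. *)
Lemma near_sg_quotients : p.[c] = 0 ->
  \forall y \near c, (p.[y] * q.[y] < 0) = (g.[c] * (y - c) < 0).
Proof.
move=> pc; have := quotient_root; rewrite pc eqxx => /esym/andP[/eqP fc gc].
have [a [b [a0 b0 E]]] := log_derivative_identity fc.
near=> y.
have sa : Num.sg a.[y] = 1.
  by rewrite -(gtr0_sg a0); near: y; apply: near_sg_horner; rewrite gt_eqF.
have sb : Num.sg b.[y] = 1.
  by rewrite -(gtr0_sg b0); near: y; apply: near_sg_horner; rewrite gt_eqF.
have sg : Num.sg g.[y] = Num.sg g.[c] by near: y; exact: near_sg_horner.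
have qy : Num.sg q.[y] != 0.
  have -> : Num.sg q.[y] = Num.sg q.[c].
    by near: y; apply: near_sg_horner; exact: pq.
  by rewrite sgr_eq0 pq.
move/(congr1 (fun r => Num.sg r.[y])): E.
rewrite !hornerM hornerXsubC !sgrM sa sb sg !mul1r => E.
rewrite -sgr_lt0 -[RHS]sgr_lt0 !sgrM.
suff -> : Num.sg p.[y] * Num.sg q.[y] = Num.sg g.[c] * Num.sg (y - c) by [].
have gg : Num.sg g.[c] * Num.sg g.[c] = 1 by rewrite -expr2 sqr_sg gc.
have qq : Num.sg q.[y] * Num.sg q.[y] = 1.
  by rewrite -expr2 sqr_sg -sgr_eq0 qy.
have -> : Num.sg (y - c) = Num.sg g.[c] * (Num.sg p.[y] * Num.sg q.[y]).
  by rewrite mulrA -E -mulrA qq mulr1.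
by rewrite mulrA gg mul1r.
Unshelve. all: by end_near. Qed.
End AtRoot.

(** At a root c of g_0, the first entry disappears from the count; around c it
    contributes a change exactly when g_0 g_1 < 0. *)
Lemma variation_reduced_Syl_near (R : realType) (f g : {poly R}) (c : R) :
  f != 0 -> \forall y \near c,
  variation_at (reduced_Syl f g) y%:E
  = (((f.[c] == 0) && (g.[c] != 0) && (g.[c] * (y - c) < 0))%R
     + variation_at (reduced_Syl f g) c%:E)%N.
Proof.
move=> f0; rewrite /variation_at /=.
case: (reduced_SylP g f0) => d p q s fE fgE ch sE.
have pq : p.[c] = 0 -> q.[c] != 0.
  case: sE ch => [->|[s' ->]] /=; last exact: sturm_chain_no_common_root.
  by move/eqP-> => /eqP; rewrite hornerC oner_eq0.
rewrite -(quotient_root f0 fE fgE pq).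
have [pc|pc] := eqVneq p.[c] 0; last exact: sturm_chain_variation_near.
case: sE ch => [->|[s' ->]] /=.
  by move=> /eqP p1; move: pc => /eqP; rewrite p1 hornerC oner_eq0.
have qc := pq pc; move=> /andP[_ chq].
near=> y.
rewrite variation_cons2; last first.
  by near: y; apply: cvgr_neq0 qc; exact: continuous_horner.
rewrite pc variation0; congr (nat_of_bool _ + _)%N; near: y.
  exact: (near_sg_quotients f0 fE fgE pq pc).
exact: sturm_chain_variation_near.
Unshelve. all: by end_near. Qed.

(** * Jumps of the counting functions *)

(** An entry z <> c stays on the same side of y for y near c, so only the
    occurrences of c matter: c is counted by z <= y from c on, and by z < y only
    after c. *)
Lemma near_count_le (R : realType) (P : pred R) (s : seq R) (c : R) :
  \forall y \near c,
    (count (fun z => (z <= y)%R && P z) s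
     + count_mem c s * ((y < c)%R && P c))%N
    = count (fun z => (z <= c) && P z) s.
Proof.
elim: s => [|z s IHs] /=; first by near=> y.
have [->|zc] := eqVneq z c.
  near=> y; rewrite lexx mulnDl addnACA; congr (_ + _)%N; last by near: y.
  by rewrite mul1n leNgt; case: ltP; case: (P c).
near=> y; rewrite add0n -addnA; congr (_ + _)%N; last by near: y.
congr (nat_of_bool (_ && _)); near: y.
case: (ltgtP z c) zc => // zc _; near=> y.
  by apply/ltW; near: y; apply: lt_nbhsr.
by apply/negbTE; rewrite -ltNge; near: y; apply: lt_nbhsl.
Unshelve. all: by end_near. Qed.

Lemma near_count_lt (R : realType) (P : pred R) (s : seq R) (c : R) :
  \forall y \near c,
    (count (fun z => (z < c)%R && P z) s
     + count_mem c s * ((c < y)%R && P c))%N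
    = count (fun z => (z < y) && P z) s.
Proof.
elim: s => [|z s IHs] /=; first by near=> y.
have [->|zc] := eqVneq z c.
  near=> y; rewrite ltxx mulnDl addnACA; congr (_ + _)%N; last by near: y.
  by rewrite mul1n.
near=> y; rewrite add0n -addnA; congr (_ + _)%N; last by near: y.
congr (nat_of_bool (_ && _)); near: y.
case: (ltgtP z c) zc => // zc _; near=> y; apply/esym.
  by near: y; apply: lt_nbhsr.
by apply/negbTE; rewrite -leNgt; apply/ltW; near: y; apply: lt_nbhsl.
Unshelve. all: by end_near. Qed.

Lemma count_disjointU (T : Type) (P P1 P2 : pred T) (s : seq T) :
  (forall z, P z = P1 z || P2 z) -> (forall z, P1 z -> ~~ P2 z) ->
  count P s = (count P1 s + count P2 s)%N.
Proof.
move=> PE disj; rewrite (eq_count PE) -count_predUI.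
rewrite [X in (_ + X)%N](eq_count (a2 := pred0)) ?count_pred0 ?addn0 //.
by move=> z /=; case: (P1 z) (disj z) => //= /(_ isT)/negbTE.
Qed.

(** * From local to global *)

(** As a real-valued function, F has derivative zero everywhere. *)
Lemma locally_constant_int (R : realType) (F : R -> int) :
  (forall c, \forall y \near c, F y = F c) -> forall x y, F x = F y.
Proof.
move=> locF x y; apply/eqP; rewrite -(eqr_int R); apply/eqP.
apply: (@is_derive_0_is_cst R (fun x => (F x)%:~R)) => c.
apply: near_eq_is_derive (is_derive_cst ((F c)%:~R : R) c 1).
by near=> z; rewrite /= (near (locF c) z).
Unshelve. all: by end_near. Qed.

Lemma near_pinfty_sg_horner (R : realType) (p : {poly R}) :
  \forall y \near +oo, Num.sg p.[y] = Num.sg (lead_coef p).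
Proof.
have pos (q : {poly R}) : 0 < lead_coef q -> \forall y \near +oo, 0 < q.[y].
  move=> q0; have [n nq] := poly_pinfty_gt_lc q0.
  near=> y; apply: lt_le_trans q0 (nq _ _); near: y.
  by apply: nbhs_pinfty_ge; rewrite num_real.
have [p0|p0|/eqP] := ltrgt0P (lead_coef p).
- near=> y; rewrite [RHS]gtr0_sg // gtr0_sg //; near: y; exact: pos.
- have /pos Np0 : 0 < lead_coef (- p) by rewrite lead_coefN oppr_gt0.
  near=> y; rewrite [RHS]ltr0_sg // ltr0_sg // -oppr_gt0 -hornerN.
  by near: y; exact: Np0.
- by rewrite lead_coef_eq0 => /eqP ->; near=> y; rewrite horner0 lead_coef0.
Unshelve. all: by end_near. Qed.

Lemma near_in_seq (T : Type) (I : eqType) (F : set_system T) (FF : Filter F)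
    (s : seq I) (P : I -> T -> Prop) :
  {in s, forall i, \forall x \near F, P i x} ->
  \forall x \near F, {in s, forall i, P i x}.
Proof.
elim: s => [|i s IHs] Ps; first by near=> x.
near=> x => j; rewrite inE => /predU1P[->|].
  by near: x; apply: Ps; rewrite mem_head.
by move: j; near: x; apply: IHs => j js; apply: Ps; rewrite inE js orbT.
Unshelve. all: by end_near. Qed.

Lemma near_pinfty_variation (R : realType) (s : seq {poly R}) :
  \forall y \near +oo,
    variation [seq p.[y] | p <- s] = variation [seq lead_coef p | p <- s].
Proof.
have : \forall y \near +oo,
    {in s, forall p, Num.sg p.[y] = Num.sg (lead_coef p)}.
  by apply: near_in_seq => p _; exact: near_pinfty_sg_horner.
by apply: filterS => y; exact: eq_variation_sg.
Qed.

(** * The potential *)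

Section Potential.
Variables (R : realType) (f g : {poly R}).
Hypothesis f0 : f != 0.

Definition distinct_roots : seq R := fset_set [set z : R | f.[z] = 0]%classic.

Lemma mem_roots z : (z \in distinct_roots) = (f.[z] == 0).
Proof.
rewrite /distinct_roots in_fset_set; last exact: finite_set_roots.
by apply/idP/eqP => [/set_mem|fz]; rewrite ?inE.
Qed.

Definition potential (a : \bar R) : int :=
  (variation_at (reduced_Syl f g) a)%:Z
  + (count (fun z => (z%:E <= a)%E && (0 < g.[z])) distinct_roots)%:Z
  - (count (fun z => (z%:E < a)%E && (g.[z] < 0)) distinct_roots)%:Z.

(** The jump of the variation at c cancels those of the two counting functions. *)
Lemma potential_near c : \forall y \near c, potential y%:E = potential c%:E.
Proof.
have rc : count_mem c distinct_roots = (f.[c] == 0) :> nat.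
  by rewrite count_uniq_mem ?fset_uniq ?mem_roots.
have := variation_reduced_Syl_near g c f0.
have := near_count_le (fun z => 0 < g.[z]) distinct_roots c.
have := near_count_lt (fun z => g.[z] < 0) distinct_roots c.
rewrite rc /potential; apply: filterS3 => y clt cle ->.
have e1 (x : R) :
   count (fun z => (z%:E <= x%:E)%E && (0 < g.[z])) distinct_roots
   = count (fun z => (z <= x)%R && (0 < g.[z])) distinct_roots.
  by apply: eq_count => z; rewrite lee_fin.
have e2 (x : R) :
   count (fun z => (z%:E < x%:E)%E && (g.[z] < 0)) distinct_roots
   = count (fun z => (z < x)%R && (g.[z] < 0)) distinct_roots.
  by apply: eq_count => z; rewrite lte_fin.
rewrite !e1 !e2 -clt -cle.
have -> : (f.[c] == 0) && (g.[c] != 0) && (g.[c] * (y - c) < 0)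
  = (f.[c] == 0) && ((0 < g.[c]) && (y < c) || (g.[c] < 0) && (c < y)).
  rewrite -andbA; congr andb; case: (ltrgt0P g.[c]) => gc //=.
  - by rewrite pmulr_rlt0 // subr_lt0 orbF.
  - by rewrite nmulr_rlt0 // subr_gt0.
rewrite !PoszD !PoszM.
case: (f.[c] == 0) => /=; last by rewrite !mul0r !addr0 add0r.
rewrite !mul1r.
case: (ltrgt0P g.[c]) => _; case: (ltgtP y c) => _ /=; lia.
Qed.

Lemma potential_real_const x y : potential x%:E = potential y%:E.
Proof.
exact: (@locally_constant_int R (fun x => potential x%:E) potential_near).
Qed.

(** Beyond all the roots of f, the counts have their final values and the terms of
    the sequence have the signs of their leading coefficients. *)
Lemma potential_pinfty : exists x : R, potential +oo%E = potential x%:E.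
Proof.
near (pinfty_nbhs R) => x; exists x.
have V : variation_at (reduced_Syl f g) +oo%E
       = variation_at (reduced_Syl f g) x%:E.
  by apply/esym; near: x; exact: near_pinfty_variation.
have rx : {in distinct_roots, forall z, z < x}.
  near: x; apply: near_in_seq => z _.
  by apply: nbhs_pinfty_gt; rewrite num_real.
rewrite /potential V.
congr (_ + Posz _ - Posz _); apply: eq_in_count => z /rx zx.
  by rewrite leey lee_fin ltW.
by rewrite ltry lte_fin zx.
Unshelve. all: by end_near. Qed.

Lemma potential_ninfty : exists x : R, potential -oo%E = potential x%:E.
Proof.
near (pinfty_nbhs R) => x; exists (- x).
have V : variation_at (reduced_Syl f g) -oo%E
       = variation_at (reduced_Syl f g) (- x)%:E.
  transitivity
    (variation [seq p.[x] | p <- [seq p \Po - 'X | p <- reduced_Syl f g]]).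
    rewrite /variation_at (map_comp lead_coef (fun p => p \Po - 'X)) /=.
    by apply/esym; near: x; exact: near_pinfty_variation.
  rewrite -map_comp; congr variation; apply: eq_map => p /=.
  by rewrite horner_comp hornerN hornerX.
have rx : {in distinct_roots, forall z, - x < z}.
  near: x; apply: near_in_seq => z _; near=> x.
  by rewrite ltrNl; near: x; apply: nbhs_pinfty_gt; rewrite num_real.
rewrite /potential V.
congr (_ + Posz _ - Posz _); apply: eq_in_count => z /rx zx.
  by rewrite leeNy_eq lee_fin leNgt zx.
have -> : (z%:E < (- x)%:E)%E = false by rewrite lte_fin ltNge (ltW zx).
by rewrite [(_ < -oo)%E]ltNge leNye.
Unshelve. all: by end_near. Qed.

Lemma potential_const a b : potential a = potential b.
Proof.
have toR (e : \bar R) : exists x : R, potential e = potential x%:E.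
  case: e => [x||]; first by exists x.
    exact: potential_pinfty.
  exact: potential_ninfty.
have [[x ->] [y ->]] := (toR a, toR b); exact: potential_real_const.
Qed.

Lemma card_roots (A : set R) (P : pred R) :
  (forall z, A z <-> f.[z] = 0 /\ P z) ->
  #|` fset_set A| = count P distinct_roots.
Proof.
move=> AE; rewrite -size_filter.
have finA : finite_set A.
  by apply: sub_finite_set (finite_set_roots f0) => z /AE[].
apply/perm_size/uniq_perm; rewrite ?filter_uniq ?fset_uniq // => z.
rewrite mem_filter mem_roots in_fset_set //.
apply/idP/andP => [/set_mem/AE[-> ->] //|[Pz /eqP fz]].
by rewrite inE; apply/AE.
Qed.
End Potential.

Theorem theorem3 (R : realType) (f g : {poly R}) (hf : f != 0)
    (a b : \bar R) (hab : (a < b)%E) :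
  (variation_at (reduced_Syl f g) a)%:Z - (variation_at (reduced_Syl f g) b)%:Z
  = #|` fset_set [set z : R | (a < z%:E <= b)%E /\ (f.[z] = 0 /\ 0 < g.[z])]%classic|%:Z
    - #|` fset_set [set z : R | (a <= z%:E < b)%E /\ (f.[z] = 0 /\ g.[z] < 0)]%classic|%:Z.
Proof.
rewrite (@card_roots R f hf _
  (fun z => (a < z%:E <= b)%E && (0 < g.[z]))); last first.
  by move=> z /=; split=> [[-> [-> ->]]|[-> /andP[-> ->]]].
rewrite (@card_roots R f hf _
  (fun z => (a <= z%:E < b)%E && (g.[z] < 0))); last first.
  by move=> z /=; split=> [[-> [-> ->]]|[-> /andP[-> ->]]].
have := potential_const g hf a b; rewrite /potential.
rewrite (@count_disjointU _ (fun z => (z%:E <= b)%E && (0 < g.[z]))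
  (fun z => (z%:E <= a)%E && (0 < g.[z]))
  (fun z => (a < z%:E <= b)%E && (0 < g.[z]))).
- rewrite (@count_disjointU _ (fun z => (z%:E < b)%E && (g.[z] < 0))
    (fun z => (z%:E < a)%E && (g.[z] < 0))
    (fun z => (a <= z%:E < b)%E && (g.[z] < 0))).
  + move: (count _ _) (count _ _) (count _ _) (count _ _) => ? ? ? ?; lia.
  + move=> z; rewrite -andb_orl; congr andb; case: (ltP z%:E a) => //= za.
    exact: lt_trans za hab.
  + by move=> z /andP[za _]; rewrite leNgt za.
- move=> z; rewrite -andb_orl; congr andb; case: (leP z%:E a) => //= za.
  by rewrite ltW // (le_lt_trans za hab).
- by move=> z /andP[za _]; rewrite ltNge za.
Qed.
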